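(* Assume $X$ is bounded and $F$ is monotone: $\langle F(x_1)-F(x_2),x_1-x_2\rangle\ge0$ for all $x_1,x_2\in X$. Let $\{x_t\}$ be generated by the SBOE method with $p_i=\frac1b$ for all $i$, and let $\{\theta_t\}$ be nonnegative numbers such that for all $t=1,\dots,k$, $$\theta_{t+1}\gamma_{t+1}\lambda_{t+1}=\theta_t\gamma_tb,\quad\theta_{t-1}\gamma_{t-1}b\ge\theta_t\gamma_t(b-1),\quad\theta_{t-1}\ge16\bar L^2\gamma_t^2\lambda_t^2\theta_t,\quad\theta_t\le\theta_{t-1},$$ and $4L^2\gamma_k^2\le1$. Let $S=\sum_{t=1}^{k-1}[\theta_t\gamma_tb-\theta_{t+1}\gamma_{t+1}(b-1)]+\theta_k\gamma_kb$ (assumed positive) and $$\bar x_{k+1}=\frac{\sum_{t=1}^{k-1}[\theta_t\gamma_tb-\theta_{t+1}\gamma_{t+1}(b-1)]x_{t+1}+\theta_k\gamma_kbx_{k+1}}{S}.$$ Then $$\mathbb{E}[\mathrm{gap}(\bar x_{k+1})]\le\frac{\theta_1}{S}\max_{x\in X}\big[5(b+1)V(x_1,x)+\gamma_1(b-1)\langle F(x_1),x_1-x\rangle\big].$$ In particular, if $\gamma_t=\frac1{4\bar Lb}$, $\lambda_t=b$ and $\theta_t=1$ for all $t$, then $$\mathbb{E}[\mathrm{gap}(\bar x_{k+1})]\le\frac{4\bar Lb}{k-1+b}\max_{x\in X}\Big[5(b+1)V(x_1,x)+\frac{b-1}{4\bar Lb}\langle F(x_1),x_1-x\rangle\Big]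.$$
   Context: Let $X=X_1\times\cdots\times X_b\subseteq\mathbb{R}^n$, where each $X_i\subseteq\mathbb{R}^{n_i}$ is nonempty closed convex and $n_1+\dots+n_b=n$; write $x=(x^{(1)},\dots,x^{(b)})$. Each $\mathbb{R}^{n_i}$ carries the Euclidean norm $\|\cdot\|_i$, and $\|x\|^2=\sum_i\|x^{(i)}\|_i^2$ is the Euclidean norm on $\mathbb{R}^n$. For $F:X\to\mathbb{R}^n$ let $F_i(x)$ be its $i$-th block; assume $\|F(x_1)-F(x_2)\|\le L\|x_1-x_2\|$ and $\|F_i(x_1)-F_i(x_2)\|_i\le\bar L\|x_1-x_2\|$ for all $i$ and $x_1,x_2\in X$. Take $\omega_i(u)=\frac12\|u\|_i^2$, so $V_i(u,v)=\frac12\|u-v\|_i^2$ and $V(x,y)=\sum_iV_i(x^{(i)},y^{(i)})=\frac12\|x-y\|^2$. SBOE method: given $x_0=x_1\in X$, nonnegative $\{\gamma_t\},\{\lambda_t\}$ and probabilities $p_1,\dots,p_b$; for $t=1,\dots,k$ draw $i_t$ with $\mathbb{P}(i_t=i)=p_i$ independently of the past, set $x_{t+1}^{(i_t)}=\operatorname{argmin}_{u\in X_{i_t}}\gamma_t\langle F_{i_t}(x_t)+\lambda_t(F_{i_t}(x_t)-F_{i_t}(x_{t-1})),u\rangle+V_{i_t}(x_t^{(i_t)},u)$ and $x_{t+1}^{(i)}=x_t^{(i)}$ for $i\ne i_t$. The weak gap is $\mathrm{gap}(\bar x)=\max_{x\in X}\langle F(x),\bar x-x\rangle$; expectation is over $i_1,\dots,i_k$.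 *)

(* Defs.v *)
From HB Require Import structures.
From mathcomp Require Import all_boot all_order all_algebra.
From mathcomp Require Import all_classical all_reals all_analysis.

Set Implicit Arguments.
Unset Strict Implicit.
Unset Printing Implicit Defensive.

Import Order.TTheory GRing.Theory Num.Theory.
Import numFieldNormedType.Exports.
Local Open Scope classical_set_scope.
Local Open Scope ring_scope.

Section SBOE.
Variable R : realType.
Variables (n b : nat).

(* Vectors of R^n are row vectors 'rV[R]_n.  The block decomposition
   R^n = R^{n_1} x ... x R^{n_b} is given by a map blk : 'I_n -> 'I_b
   assigning each coordinate to its block; R^{n_i} is identified with the
   subspace of vectors supported on the coordinates of block i. *)

Definition dotv (u v : 'rV[R]_n) : R := \sum_(j < n) u 0 j * v 0 j.
Definition enorm (u : 'rV[R]_n) : R := Num.sqrt (\sum_(j < n) u 0 j ^+ 2).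

(* V(x,y) = 1/2 ||x - y||^2  (also V_i on block-supported vectors) *)
Definition Vdist (u v : 'rV[R]_n) : R := 2^-1 * enorm (u - v) ^+ 2.

Definition restr (blk : 'I_n -> 'I_b) (i : 'I_b) (v : 'rV[R]_n) : 'rV[R]_n :=
  \row_j (if blk j == i then v 0 j else 0).

Definition block_space (blk : 'I_n -> 'I_b) (i : 'I_b) : set 'rV[R]_n :=
  [set v | forall j, blk j != i -> v 0 j = 0].

Definition convex_set_of (A : set 'rV[R]_n) : Prop :=
  forall u v (t : R), A u -> A v -> 0 <= t -> t <= 1 -> A (t *: u + (1 - t) *: v).

Definition prodX (blk : 'I_n -> 'I_b) (Xs : 'I_b -> set 'rV[R]_n) : set 'rV[R]_n :=
  [set x | forall i, Xs i (restr blk i x)].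

(* weak gap: gap(xb) = max_{x in X} <F(x), xb - x>  (sup; attained) *)
Definition gap (X : set 'rV[R]_n) (F : 'rV[R]_n -> 'rV[R]_n) (xb : 'rV[R]_n) : R :=
  sup [set dotv (F x) (xb - x) | x in X].

Definition sboe_step (blk : 'I_n -> 'I_b) (Xs : 'I_b -> set 'rV[R]_n)
  (F : 'rV[R]_n -> 'rV[R]_n) (gam lam : R) (i : 'I_b)
  (xprev xcur xnext : 'rV[R]_n) : Prop :=
  let g := restr blk i (F xcur + lam *: (F xcur - F xprev)) in
  let phi := fun u => gam * dotv g u + Vdist (restr blk i xcur) u in
  (forall j, blk j != i -> xnext 0 j = xcur 0 j) /\
  Xs i (restr blk i xnext) /\
  (forall u, Xs i u -> phi (restr blk i xnext) <= phi u).

(* Expectation over i_1,...,i_k drawn i.i.d. uniformly on the b blocks: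
   omega t = i_{t+1} for t : 'I_k. *)
Definition expect_unif (k : nat) (G : {ffun 'I_k -> 'I_b} -> R) : R :=
  \sum_(omega : {ffun 'I_k -> 'I_b}) (b%:R^-1) ^+ k * G omega.

Definition avg_weight (k : nat) (gam theta : nat -> R) (t : nat) : R :=
  if t == k then theta k * gam k * b%:R
  else theta t * gam t * b%:R - theta t.+1 * gam t.+1 * (b%:R - 1).

Definition Ssum (k : nat) (gam theta : nat -> R) : R :=
  \sum_(1 <= t < k.+1) avg_weight k gam theta t.

Definition xbar (k : nat) (gam theta : nat -> R) (x : nat -> 'rV[R]_n) : 'rV[R]_n :=
  (Ssum k gam theta)^-1 *: \sum_(1 <= t < k.+1) avg_weight k gam theta t *: x t.+1.

End SBOE.

(* Main.v *)
Require Import Defs.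
From HB Require Import structures.
From mathcomp Require Import all_boot all_order all_algebra.
From mathcomp Require Import all_classical all_reals all_analysis.
From mathcomp Require Import ring lra.
Import Order.TTheory GRing.Theory Num.Theory.
Import numFieldNormedType.Exports.
Local Open Scope classical_set_scope.
Local Open Scope ring_scope.

(* Let d_t be the step from x_t that updates all blocks, and e_t the actual step,
   i.e. the block i_t of d_t. The noise delta_t = b e_t - d_t is centered given the
   past. Summing the proximal inequality for d_t over t, weighted by theta_t, the
   terms <F(x_t) - F(x_{t-1}), x_t - x> telescope and monotonicity makes the gap at x
   appear. The gap is maximized over x inside the expectation, so <delta_t, x> is not
   centered; it is traded for <delta_t, v_t> by means of the sequence v_1 = x_1,
   v_{t+1} = v_t - delta_t / (2b), at the cost of the initial distance 2b V(x_1, x) and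
   of |delta_t|^2 / (4b). The remainder does not depend on x and has nonpositive mean,
   because e_t has conditional second moment |d_t|^2 / b. This gives the constant 3b,
   which is at most 5(b + 1). *)

(** * Euclidean inner product and norm *)

Section InnerProduct.
Context {R : realType} {n : nat}.
Implicit Types u v w : 'rV[R]_n.

Lemma dotvC u v : dotv u v = dotv v u.
Proof. by apply: eq_bigr => j _; rewrite mulrC. Qed.

Lemma dotvDl u v w : dotv (u + v) w = dotv u w + dotv v w.
Proof. by rewrite -big_split; apply: eq_bigr => j _; rewrite mxE mulrDl. Qed.

Lemma dotvZl a u w : dotv (a *: u) w = a * dotv u w.
Proof. by rewrite mulr_sumr; apply: eq_bigr => j _; rewrite mxE mulrA. Qed.

Lemma dotvNl u w : dotv (- u) w = - dotv u w.
Proof. by rewrite -scaleN1r dotvZl mulN1r. Qed.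

Lemma dotvDr u v w : dotv w (u + v) = dotv w u + dotv w v.
Proof. by rewrite dotvC dotvDl !(dotvC w). Qed.

Lemma dotvZr a u w : dotv w (a *: u) = a * dotv w u.
Proof. by rewrite dotvC dotvZl (dotvC w). Qed.

Lemma dotvNr u w : dotv w (- u) = - dotv w u.
Proof. by rewrite dotvC dotvNl (dotvC w). Qed.

Definition dotvE := (dotvDl, dotvDr, dotvNl, dotvNr, dotvZl, dotvZr).

Lemma dotv0l w : dotv 0 w = 0.
Proof. by rewrite -(scale0r 0) dotvZl mul0r. Qed.

Lemma dotv_suml (I : Type) (r : seq I) (P : pred I) (f : I -> 'rV[R]_n) w :
  dotv (\sum_(i <- r | P i) f i) w = \sum_(i <- r | P i) dotv (f i) w.
Proof.
apply: (big_ind2 (fun u a => dotv u w = a)) => [|u a v c <- <-|//].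
  exact: dotv0l.
exact: dotvDl.
Qed.

Lemma dotv_sumr (I : Type) (r : seq I) (P : pred I) (f : I -> 'rV[R]_n) w :
  dotv w (\sum_(i <- r | P i) f i) = \sum_(i <- r | P i) dotv w (f i).
Proof. by rewrite dotvC dotv_suml; under eq_bigr do rewrite dotvC. Qed.

Lemma dotvv_ge0 u : 0 <= dotv u u.
Proof. by apply: sumr_ge0 => j _; rewrite -expr2 sqr_ge0. Qed.

Lemma dotvv_eq0 u : dotv u u <= 0 -> u = 0.
Proof.
move=> u0; have /eqP : dotv u u = 0 by apply/eqP; rewrite eq_le u0 dotvv_ge0.
rewrite psumr_eq0; last by move=> j _; rewrite -expr2 sqr_ge0.
move=> /allP h; apply/rowP => j; rewrite mxE.
by have := h j (mem_index_enum j); rewrite /= mulf_eq0 orbb => /eqP.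
Qed.

Lemma enorm_sqr u : enorm u ^+ 2 = dotv u u.
Proof.
rewrite /enorm sqr_sqrtr; last by apply: sumr_ge0 => j _; rewrite sqr_ge0.
by apply: eq_bigr => j _; rewrite expr2.
Qed.

Lemma enorm_le_sqr u v (c : R) :
  enorm u <= c * enorm v -> dotv u u <= c ^+ 2 * dotv v v.
Proof.
move=> h; rewrite -!enorm_sqr -exprMn.
by rewrite ler_pXn2r ?nnegrE ?sqrtr_ge0 //; apply: le_trans h; rewrite sqrtr_ge0.
Qed.

Lemma VdistE u v : Vdist u v = 2^-1 * dotv (u - v) (u - v).
Proof. by rewrite /Vdist enorm_sqr. Qed.

Lemma Vdist_ge0 u v : 0 <= Vdist u v.
Proof. by rewrite VdistE mulr_ge0 ?invr_ge0 ?ler0n ?dotvv_ge0. Qed.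

End InnerProduct.

(** * Orthogonal decomposition into blocks *)

Section Blocks.
Context {R : realType} {n b : nat} (blk : 'I_n -> 'I_b).
Implicit Types u v w : 'rV[R]_n.

Lemma restrD i u v : restr blk i (u + v) = restr blk i u + restr blk i v.
Proof. by apply/rowP => j; rewrite !mxE; case: eqP => _; rewrite ?addr0. Qed.

Lemma restrN i u : restr blk i (- u) = - restr blk i u.
Proof. by apply/rowP => j; rewrite !mxE; case: eqP => _; rewrite ?oppr0. Qed.

Lemma restrZ i a u : restr blk i (a *: u) = a *: restr blk i u.
Proof. by apply/rowP => j; rewrite !mxE; case: eqP => _; rewrite ?mulr0. Qed.

Lemma dotv_restrl i u v : dotv (restr blk i u) (restr blk i v) = dotv (restr blk i u) v.
Proof. by apply: eq_bigr => j _; rewrite !mxE; case: eqP; rewrite ?mul0r. Qed.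

Lemma restr_id i u : (forall j, blk j != i -> u 0 j = 0) -> restr blk i u = u.
Proof. by move=> h; apply/rowP => j; rewrite !mxE; case: eqP => // /eqP /h. Qed.

Lemma restr_neq i i' u : (forall j, blk j != i -> u 0 j = 0) ->
  i' != i -> restr blk i' u = 0.
Proof.
move=> h ii'; apply/rowP => j; rewrite !mxE; case: eqP => // ji.
by apply: h; rewrite ji.
Qed.

Lemma sum_restr u : \sum_i restr blk i u = u.
Proof.
apply/rowP => j; rewrite summxE (bigD1 (blk j)) //= mxE eqxx big1 ?addr0 // => i ij.
by rewrite mxE eq_sym (negbTE ij).
Qed.

Lemma sum_dotv_restr u v : \sum_i dotv (restr blk i u) (restr blk i v) = dotv u v.
Proof.
under eq_bigr do rewrite dotv_restrl.
by rewrite -dotv_suml sum_restr.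
Qed.

End Blocks.

(** * Resampling one draw, and averages over uniform draws *)

Section Update.
Context {k b : nat}.

Definition upd (omega : {ffun 'I_k -> 'I_b}) (t : nat) (i : 'I_b) :
  {ffun 'I_k -> 'I_b} := [ffun s : 'I_k => if s == t :> nat then i else omega s].

(** Exchanging the draw at [t] with a fresh one is an involution of the pairs [(omega, i)], so
    resampling preserves the uniform law. This takes the place of conditioning on the past. *)
Lemma sum_upd (R : realType) (G : {ffun 'I_k -> 'I_b} -> R) (t : 'I_k) :
  \sum_omega \sum_i G (upd omega t i) = b%:R * \sum_omega G omega.
Proof.
rewrite pair_bigA /=.
pose swap (p : {ffun 'I_k -> 'I_b} * 'I_b) := (upd p.1 t p.2, p.1 t).
have swapK : involutive swap.
  move=> [om i]; rewrite /swap /=; congr pair; last by rewrite ffunE eqxx.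
  by apply/ffunP => s; rewrite !ffunE; case: eqP => // /val_inj ->.
rewrite (reindex_inj (inv_inj swapK)) /=.
under eq_bigr => p _.
  have -> : upd (upd p.1 t p.2) t (p.1 t) = p.1 by have := swapK p; case: p => om i [].
  over.
rewrite -(pair_bigA _ (fun om (i : 'I_b) => G om)) /= mulr_sumr.
by apply: eq_bigr => om _; rewrite sumr_const card_ord mulr_natl.
Qed.

End Update.

Section ExpectUnif.
Context {R : realType} {b k : nat}.
Implicit Types G : {ffun 'I_k -> 'I_b} -> R.

Lemma le_expect_unif G H : (forall omega, G omega <= H omega) ->
  expect_unif G <= expect_unif H.
Proof.
by move=> GH; apply: ler_sum => om _; rewrite ler_wpM2l // exprn_ge0 // invr_ge0 ler0n.
Qed.

Lemma expect_unif_affine (c a : R) G : (0 < b)%N ->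
  expect_unif (fun omega => c + a * G omega) = c + a * expect_unif G.
Proof.
move=> b0; rewrite /expect_unif mulr_sumr.
under eq_bigr do rewrite mulrDr mulrCA.
rewrite big_split /=; congr (_ + _).
rewrite sumr_const card_ffun !card_ord -[LHS]mulr_natl mulrA natrX exprVn mulfV ?mul1r //.
by rewrite expf_neq0 // pnatr_eq0 -lt0n.
Qed.

End ExpectUnif.

(** * The random remainder of one step and its mean *)

(** [e] is the actual step, [d] the full one, [h] a vector known before the draw. The coefficient
    3/4 is 1/2 from expanding the distances, 1/8 from Young's inequality and 1/8 set aside for the
    next step's Young term. *)
Definition step_noise {R : realType} {n : nat} (bt : R) (e d h : 'rV[R]_n) : R :=
  3 / 4 * bt * dotv e e - dotv d d + dotv (bt *: e - d) h
  + (4 * bt)^-1 * dotv (bt *: e - d) (bt *: e - d).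

(* With [i] uniform, [restr blk i d] has mean [d / b], so [b *: restr blk i d - d] is
   centered with second moment [(b - 1) * |d|^2]. *)
Lemma sum_block_noise_le0 (R : realType) (n b : nat) (blk : 'I_n -> 'I_b)
    (d h : 'rV[R]_n) : (0 < b)%N ->
  \sum_i step_noise b%:R (restr blk i d) d h <= 0.
Proof.
move=> b0; have b0' : (0 : R) < b%:R by rewrite ltr0n.
have E i : step_noise b%:R (restr blk i d) d h
  = (b%:R - 2^-1) * dotv (restr blk i d) (restr blk i d)
    + ((4 * b%:R)^-1 - 1) * dotv d d + b%:R * dotv (restr blk i d) h - dotv d h.
  rewrite /step_noise !dotvE (dotvC d (restr _ _ _)) -(dotv_restrl blk i d d); field; lra.
under eq_bigr do rewrite E.
rewrite /= !big_split /= -!mulr_sumr !sum_dotv_restr.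
have -> : \sum_i dotv (restr blk i d) h = dotv d h by rewrite -dotv_suml sum_restr.
rewrite sumrN !sumr_const card_ord -[dotv d h *+ b]mulr_natr -[dotv d d *+ b]mulr_natr.
(* The terms in [h] cancel, and [dotv d d] is left with the coefficient (b - 1/2) + (1/4 - b) =
   -1/4. *)
have -> : ((4 * b%:R)^-1 - 1) * (dotv d d * b%:R) = (4^-1 - b%:R) * dotv d d.
  by field; lra.
have := dotvv_ge0 d; lra.
Qed.

(** * Deterministic estimates along one path *)

Lemma prox_variational (R : realType) (n : nat) (A : set 'rV[R]_n)
    (gam : R) (g c y u : 'rV[R]_n) :
  convex_set_of A -> A y ->
  (forall w, A w -> gam * dotv g y + Vdist c y <= gam * dotv g w + Vdist c w) ->
  A u -> 0 <= dotv (gam *: g + (y - c)) (u - y).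
Proof.
move=> convA Ay ymin Au; rewrite leNgt; apply/negP => D0.
set D := dotv _ _ in D0; pose W := dotv (u - y) (u - y).
have W0 : 0 <= W := dotvv_ge0 _.
(* Moving from [y] towards [u] by [t] changes the objective by [t * (D + t / 2 * W)]. This [t] lies
   in (0, 1], also when [W = 0], and makes the bracket equal to D(1 + t)/2 < 0. *)
pose t := - D / (W - D).
have WD : 0 < W - D by lra.
have t0 : 0 < t by rewrite divr_gt0 //; lra.
have tWD : t * (W - D) = - D by rewrite /t mulfVK //; lra.
have t1 : t <= 1 by rewrite ler_pdivrMr //; lra.
have := ymin _ (convA _ _ _ Au Ay (ltW t0) t1).
have -> : t *: u + (1 - t) *: y = y + t *: (u - y).
  by apply/rowP => j; rewrite !mxE; ring.
rewrite !VdistE => h.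
have {h} : 0 <= t * (D + t / 2 * W).
  move: h; rewrite /D /W; move: (u - y) => w.
  have -> : c - (y + t *: w) = (c - y) - t *: w.
    by apply/rowP => j; rewrite !mxE; ring.
  have -> : y - c = - (c - y) by rewrite opprB.
  move: (c - y) => q; rewrite !dotvE (dotvC w q); lra.
rewrite pmulr_rge0 //; nra.
Qed.

Lemma abel_sum_le (R : realDomainType) (theta P : nat -> R) (k : nat) :
  (forall t, 0 <= P t) ->
  (forall t, (t < k)%N -> theta t.+2 <= theta t.+1) ->
  \sum_(t < k.+1) theta t.+1 * (P t - P t.+1) <= theta 1%N * P 0%N - theta k.+1 * P k.+1.
Proof.
move=> P0; elim: k => [|k IH] decr; first by rewrite big_ord1 mulrBr.
rewrite big_ord_recr /=.
have := IH (fun t tk => decr t (ltnW tk)); have := decr k (ltnSn k); have := P0 k.+1.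
nra.
Qed.

(** The weights of the average are designed for this regrouping into the left-hand sides of the
    one-step bound; the unmatched first term becomes the term in [F x1] of the final estimate. *)
Lemma sum_avg_weight (R : realType) (b k : nat) (gam theta c : nat -> R) :
  (1 <= k)%N ->
  \sum_(1 <= t < k.+1) avg_weight b k gam theta t * c t.+1 =
  \sum_(t < k) (theta t.+1 * gam t.+1 * b%:R * c t.+2
                - theta t.+1 * gam t.+1 * (b%:R - 1) * c t.+1)
  + theta 1%N * gam 1%N * (b%:R - 1) * c 1%N.
Proof.
case: k => // k _; rewrite big_nat_recr //= {2}/avg_weight eqxx.
under eq_big_nat => t /andP[_ tk] do rewrite /avg_weight (ltn_eqF tk).
elim: k => [|k IH]; first by rewrite big_geq // big_ord1 /=; ring.
by rewrite big_nat_recr //= big_ord_recr /=; lra.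
Qed.

(* One step of the scheme from [x + w] to [x + w + e], [d] being the step that
   updates all the blocks at once; [v] is an auxiliary sequence which absorbs the
   part of the noise [b *: e - d] that is multiplied by the comparison point [x]. *)
Lemma step_bound (R : realType) (n : nat) (G0 G1 G2 q0 w e d v x : 'rV[R]_n)
    (gam lam th th' bt : R) :
  0 < bt -> 0 <= th ->
  let g := G1 + lam *: (G1 - G0) in
  let noise := bt *: e - d in
  gam * dotv g (w + d) + dotv d (w + d) <= 0 ->
  - (th * (gam * lam * dotv (G1 - G0) e)) <= th / 8 * dotv e e + th' / 8 * dotv q0 q0 ->
  th * gam * bt * dotv G2 (w + e) - th * gam * (bt - 1) * dotv G1 w <=
  th * ((bt * Vdist (x + w) x + 2 * bt * Vdist v x)
        - (bt * Vdist (x + w + e) x + 2 * bt * Vdist (v - (2 * bt)^-1 *: noise) x))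
  + th * step_noise bt e d (gam *: g + (x + w - v))
  + bt / 8 * (th' * dotv q0 q0 - th * dotv e e)
  + (th * gam * bt * dotv (G2 - G1) (w + e) - th * gam * lam * dotv (G1 - G0) w).
Proof.
move=> bt0 th0 g noise vi young.
have Ex : bt * Vdist (x + w) x - bt * Vdist (x + w + e) x
    = - bt * dotv w e - bt / 2 * dotv e e.
  rewrite !VdistE; have -> : x + w - x = w by apply/rowP => j; rewrite !mxE; ring.
  have -> : x + w + e - x = w + e by apply/rowP => j; rewrite !mxE; ring.
  by rewrite !dotvE (dotvC e w); field.
have Ev : 2 * bt * Vdist v x - 2 * bt * Vdist (v - (2 * bt)^-1 *: noise) x
    = dotv noise (v - x) - (4 * bt)^-1 * dotv noise noise.
  rewrite !VdistE; have -> : v - (2 * bt)^-1 *: noise - x = (v - x) - (2 * bt)^-1 *: noise.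
    by rewrite addrAC.
  generalize (v - x) noise => p q.
  by rewrite !dotvE (dotvC p q); field; lra.
have -> : bt * Vdist (x + w) x + 2 * bt * Vdist v x
        - (bt * Vdist (x + w + e) x + 2 * bt * Vdist (v - (2 * bt)^-1 *: noise) x)
   = - bt * dotv w e - bt / 2 * dotv e e
     + (dotv noise (v - x) - (4 * bt)^-1 * dotv noise noise).
  by rewrite -Ex -Ev; ring.
have Ew : dotv noise (gam *: g + (x + w - v))
    = gam * dotv g noise + dotv noise w - dotv noise (v - x).
  by rewrite (dotvC g) -dotvZr -dotvNr -!dotvDr; congr dotv; apply/rowP => j; rewrite !mxE; ring.
rewrite /step_noise -/noise Ew {Ex Ev Ew}.
(* The claim is now [th] times the variational inequality plus [bt] times the Young bound. *)
have := mulr_ge0 th0 (_ : 0 <= - (gam * dotv g (w + d) + dotv d (w + d))).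
rewrite oppr_ge0 => /(_ vi); move: young => /(ler_wpM2l (ltW bt0)).
rewrite /g /noise !dotvE (dotvC e w); lra.
Qed.

(** The weight 1/8 is the one that turns the bound on [D] into the factor 16 of the step-size
    condition. *)
Lemma young_ineq (R : realType) (n : nat) (D e : 'rV[R]_n) (a : R) :
  - (a * dotv D e) <= 8^-1 * dotv e e + 2 * a ^+ 2 * dotv D D.
Proof.
have := dotvv_ge0 (e + (4 * a) *: D); rewrite !dotvE (dotvC e D); lra.
Qed.

(** Sums the one-step bound along a single path. The comparison point [x] does not occur in the
    [step_noise] terms, which is what later allows the supremum over [x] to be taken before the
    expectation. *)
Lemma path_bound (R : realType) (n b k : nat) (gam lam theta : nat -> R)
    (L Lb : R) (F : 'rV[R]_n -> 'rV[R]_n) (y d v : nat -> 'rV[R]_n) (x : 'rV[R]_n) :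
  let g t := F (y t.+1) + lam t.+1 *: (F (y t.+1) - F (y t)) in
  (0 < b)%N -> (1 <= k)%N -> (forall t, 0 <= theta t) ->
  (forall t, (t < k)%N ->
    theta t.+2 * gam t.+2 * lam t.+2 = theta t.+1 * gam t.+1 * b%:R) ->
  (forall t, (t < k)%N ->
    16 * Lb ^+ 2 * gam t.+1 ^+ 2 * lam t.+1 ^+ 2 * theta t.+1 <= theta t) ->
  (forall t, (t < k)%N -> theta t.+1 <= theta t) ->
  4 * L ^+ 2 * gam k ^+ 2 <= 1 ->
  y 1%N = y 0%N -> v 0%N = y 1%N ->
  (forall t, v t.+1 = v t - (2 * b%:R)^-1 *: (b%:R *: (y t.+2 - y t.+1) - d t)) ->
  (forall t, (t < k)%N ->
    gam t.+1 * dotv (g t) (y t.+1 - x + d t) + dotv (d t) (y t.+1 - x + d t) <= 0) ->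
  (forall t, (t < k)%N -> exists2 D,
    dotv D D <= Lb ^+ 2 * dotv (y t.+1 - y t) (y t.+1 - y t) &
    dotv (F (y t.+1) - F (y t)) (y t.+2 - y t.+1) = dotv D (y t.+2 - y t.+1)) ->
  dotv (F (y k.+1) - F (y k)) (F (y k.+1) - F (y k))
    <= L ^+ 2 * dotv (y k.+1 - y k) (y k.+1 - y k) ->
  \sum_(1 <= t < k.+1) avg_weight b k gam theta t * dotv (F (y t.+1)) (y t.+1 - x) <=
  theta 1%N * (3 * b%:R * Vdist (y 1%N) x
               + gam 1%N * (b%:R - 1) * dotv (F (y 1%N)) (y 1%N - x))
  + \sum_(t < k) theta t.+1 *
      step_noise b%:R (y t.+2 - y t.+1) (d t) (gam t.+1 *: g t + (y t.+1 - v t)).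
Proof.
move=> g b0 k1 th0 thgl thL thd gamL y10 v0 vS vi lipb lip.
have b0' : (0 : R) < b%:R by rewrite ltr0n.
(* [P] decreases up to noise and is summed by parts with the weights [theta]; [Q] collects the
   extrapolation terms, which telescope exactly. *)
pose P t := b%:R * Vdist (y t.+1) x + 2 * b%:R * Vdist (v t) x.
pose q t := dotv (y t.+1 - y t) (y t.+1 - y t).
pose C t := theta t.+1 * gam t.+1 * lam t.+1
            * dotv (F (y t.+1) - F (y t)) (y t.+1 - x).
pose Q t := - (b%:R / 8) * (theta t * q t) + C t.
have P0 t : 0 <= P t.
  by apply: addr_ge0; apply: mulr_ge0 (Vdist_ge0 _ _) => //; rewrite mulr_ge0 ?ler0n.
have step t : (t < k)%N ->
    theta t.+1 * gam t.+1 * b%:R * dotv (F (y t.+2)) (y t.+2 - x)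
    - theta t.+1 * gam t.+1 * (b%:R - 1) * dotv (F (y t.+1)) (y t.+1 - x)
    <= theta t.+1 * (P t - P t.+1)
       + theta t.+1 * step_noise b%:R (y t.+2 - y t.+1) (d t)
                        (gam t.+1 *: g t + (y t.+1 - v t))
       + (Q t.+1 - Q t).
  move=> tk.
  have [D DL De] := lipb _ tk.
  have young : - (theta t.+1 * (gam t.+1 * lam t.+1
        * dotv (F (y t.+1) - F (y t)) (y t.+2 - y t.+1)))
      <= theta t.+1 / 8 * dotv (y t.+2 - y t.+1) (y t.+2 - y t.+1) + theta t / 8 * q t.
    rewrite De; have := young_ineq _ _ D (y t.+2 - y t.+1) (gam t.+1 * lam t.+1).
    move=> /(ler_wpM2l (th0 t.+1)) h1.
    have a0 : 0 <= theta t.+1 * (gam t.+1 * lam t.+1) ^+ 2 by rewrite mulr_ge0 ?sqr_ge0.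
    have h2 := ler_wpM2l a0 DL.
    have h3 := ler_wpM2r (dotvv_ge0 (y t.+1 - y t)) (thL _ tk).
    rewrite /q; lra.
  have := step_bound _ _ (F (y t)) (F (y t.+1)) (F (y t.+2)) (y t.+1 - y t) (y t.+1 - x)
    (y t.+2 - y t.+1) (d t) (v t) x (gam t.+1) (lam t.+1) (theta t.+1) (theta t) b%:R
    b0' (th0 _) (vi _ tk) young.
  have -> : y t.+1 - x + (y t.+2 - y t.+1) = y t.+2 - x.
    by apply/rowP => j; rewrite !mxE; ring.
  have -> : x + (y t.+1 - x) = y t.+1 by rewrite addrC subrK.
  have -> : y t.+1 + (y t.+2 - y t.+1) = y t.+2 by rewrite addrC subrK.
  rewrite -vS /Q /C /P /q (thgl _ tk) /g; lra.
rewrite (sum_avg_weight _ _ _ _ _ (fun t => dotv (F (y t)) (y t - x)) k1).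
have := ler_sum (index_enum 'I_k) (fun t (_ : true) => step t (ltn_ord t)).
rewrite [leRHS]big_split [X in _ <= X + _]big_split /=.
rewrite -[X in _ <= _ + X](big_mkord xpredT (fun t => Q t.+1 - Q t)) telescope_sumr //.
case: k k1 thd thgl gamL lip {step lipb vi thL} => // k _ thd thgl gamL lip.
have ab := abel_sum_le _ theta P k P0 (fun t tk => thd _ (tk : (t.+1 < k.+1)%N)).
have Q0 : Q 0%N = 0 by rewrite /Q /q /C y10 !subrr !dotv0l; ring.
have PV : P 0%N = 3 * b%:R * Vdist (y 1%N) x by rewrite /P v0; ring.
(* The leftover of the telescoping is absorbed by the last distance to [x]. As 4 L^2 gam^2 <= 1 at
   the last index, Young's inequality leaves at most 1/8 of the squared last step, which the
   negative part of [Q] cancels. *)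
have fin : Q k.+1 <= theta k.+1 * P k.+1.
  rewrite /Q /C (thgl _ (ltnSn k)) /P VdistE -/(q k.+1).
  set p := y k.+2 - x; set D := F _ - F _.
  have h1 : gam k.+1 * dotv D p <= 2^-1 * dotv p p + 8^-1 * q k.+1.
    have := young_ineq _ _ D (2 *: p) (- (gam k.+1 / 2)); rewrite !dotvZr !dotvZl.
    have := ler_wpM2l (sqr_ge0 (gam k.+1)) lip; rewrite -/D -/(q k.+1).
    have := ler_wpM2r (dotvv_ge0 (y k.+2 - y k.+1)) gamL; rewrite -/(q k.+1).
    lra.
  have t0 : 0 <= theta k.+1 * b%:R by apply: mulr_ge0 => //; rewrite ler0n.
  have := ler_wpM2l t0 h1; have := mulr_ge0 t0 (Vdist_ge0 (v k.+1) x); lra.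
rewrite -PV Q0; lra.
Qed.

(** * The random iterates: uniqueness, adaptedness, feasibility *)

Lemma sboe_step_variational (R : realType) (n b : nat) (blk : 'I_n -> 'I_b)
    (Xs : 'I_b -> set 'rV[R]_n) (F : 'rV[R]_n -> 'rV[R]_n) (gam lam : R) (i : 'I_b)
    (xp xc xn u : 'rV[R]_n) :
  convex_set_of (Xs i) -> sboe_step blk Xs F gam lam i xp xc xn -> Xs i u ->
  0 <= dotv (gam *: restr blk i (F xc + lam *: (F xc - F xp))
             + (restr blk i xn - restr blk i xc)) (u - restr blk i xn).
Proof.
by move=> conv [_ [Xn min]] Xu; exact: prox_variational conv Xn min Xu.
Qed.

(** Testing each minimizer against the other and adding gives a nonpositive squared distance. The
    step being a relation, this uniqueness is what makes the iterates functions of the past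
    draws. *)
Lemma sboe_step_inj (R : realType) (n b : nat) (blk : 'I_n -> 'I_b)
    (Xs : 'I_b -> set 'rV[R]_n) (F : 'rV[R]_n -> 'rV[R]_n) (gam lam : R) (i : 'I_b)
    (xp xc xn xn' : 'rV[R]_n) :
  convex_set_of (Xs i) -> sboe_step blk Xs F gam lam i xp xc xn ->
  sboe_step blk Xs F gam lam i xp xc xn' -> xn = xn'.
Proof.
move=> conv s s'; have [e [Xn _]] := s; have [e' [Xn' _]] := s'.
have := sboe_step_variational _ _ _ _ _ _ _ _ _ _ _ _ _ conv s Xn'.
have := sboe_step_variational _ _ _ _ _ _ _ _ _ _ _ _ _ conv s' Xn.
set G := gam *: _; set c := restr blk i xc; set p := restr blk i xn.
set p' := restr blk i xn' => h h'.
have /dotvv_eq0 pp' : dotv (p - p') (p - p') <= 0.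
  by move: h h'; rewrite !dotvE (dotvC p' p); lra.
apply/rowP => j; have [ij|/[dup] /e -> /e' -> //] := eqVneq (blk j) i.
by move/rowP: pp' => /(_ j); rewrite !mxE ij eqxx => /eqP; rewrite subr_eq0 => /eqP.
Qed.

Lemma upd_id {k b : nat} (omega : {ffun 'I_k -> 'I_b}) (t : 'I_k) :
  upd omega t (omega t) = omega.
Proof. by apply/ffunP => s; rewrite ffunE; case: eqP => // /val_inj ->. Qed.

Section Process.
Context {R : realType} {n b k : nat} (blk : 'I_n -> 'I_b)
  (Xs : 'I_b -> set 'rV[R]_n) (F : 'rV[R]_n -> 'rV[R]_n) (gam lam : nat -> R)
  (x1 : 'rV[R]_n) (x : {ffun 'I_k -> 'I_b} -> nat -> 'rV[R]_n).
Context (b0 : (0 < b)%N) (conv : forall i, convex_set_of (Xs i)) (Xx1 : prodX blk Xs x1)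
  (x01 : forall omega, x omega 0%N = x1 /\ x omega 1%N = x1)
  (xstep : forall (omega : {ffun 'I_k -> 'I_b}) (t : 'I_k),
    sboe_step blk Xs F (gam t.+1) (lam t.+1) (omega t)
      (x omega t) (x omega t.+1) (x omega t.+2)).

Let extrap omega t := F (x omega t.+1) + lam t.+1 *: (F (x omega t.+1) - F (x omega t)).

Definition agree (m : nat) (omega omega' : {ffun 'I_k -> 'I_b}) :=
  forall s : 'I_k, (s < m)%N -> omega s = omega' s.

Lemma agree_upd omega t i m : (m <= t)%N -> agree m (upd omega t i) omega.
Proof. by move=> mt s sm; rewrite ffunE ltn_eqF // (leq_trans sm). Qed.

(** Draw [s] produces iterate [s.+2], so the first [m] draws determine the iterates up to index
    [m.+1]. *)
Lemma sboe_adapted omega omega' m t : (m <= k)%N -> agree m omega omega' ->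
  (t <= m.+1)%N -> x omega t = x omega' t.
Proof.
move=> mk ag; have [e0 e1] := x01 omega; have [e0' e1'] := x01 omega'.
elim/ltn_ind: t => -[_ _|[_ _|t IH tm]]; rewrite ?e0 ?e1 //.
have tk : (t < k)%N by apply: leq_trans mk.
have s := xstep omega (Ordinal tk); have s' := xstep omega' (Ordinal tk).
rewrite /= (ag (Ordinal tk) tm) (IH t) ?(IH t.+1) ?(ltnW tm) ?(ltnW (ltnW tm)) // in s.
exact: sboe_step_inj _ _ _ _ _ _ _ _ _ _ _ _ _ (conv _) s s'.
Qed.
Arguments sboe_adapted {omega omega' m t}.

(* The update of all the blocks at once, assembled from the alternative choices
   of block at step [t]. *)
Definition full_step omega t := \sum_i (x (upd omega t i) t.+2 - x omega t.+1).

(** The auxiliary sequence in summed form, its index shifted by one: [aux_seq omega t] goes with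
    [x omega t.+1]. *)
Definition aux_seq omega t :=
  x1 - (2 * b%:R)^-1 *: \sum_(s < t)
         (b%:R *: (x omega s.+2 - x omega s.+1) - full_step omega s).

(** All values of draw [t] are substituted in turn, so its actual value does not matter. *)
Lemma full_step_adapted omega omega' t : (t < k)%N -> agree t omega omega' ->
  full_step omega t = full_step omega' t.
Proof.
move=> tk ag; apply: eq_bigr => i _; congr (_ - _).
  apply: (@sboe_adapted _ _ t.+1) => // s; rewrite ltnS !ffunE.
  by case: eqP => // /eqP st; rewrite leq_eqVlt (negbTE st) => /ag.
exact: sboe_adapted (ltnW tk) ag _.
Qed.

Lemma aux_adapted omega omega' t : (t <= k)%N -> agree t omega omega' ->
  aux_seq omega t = aux_seq omega' t.
Proof.
move=> tk ag; congr (_ - _ *: _); apply: eq_bigr => s _.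
have st := ltn_ord s; congr (_ *: (_ - _) - _).
- exact: (@sboe_adapted omega omega' t).
- by apply: (@sboe_adapted omega omega' t) => //; exact: ltnW.
- apply: full_step_adapted; first exact: leq_trans tk.
  by move=> r rs; apply: ag; exact: ltn_trans st.
Qed.

(** Each summand is supported on its own block, because the alternative paths share the iterate
    [t.+1] and then change one block only. *)
Lemma restr_full_step omega (t : 'I_k) i :
  restr blk i (full_step omega t) = x (upd omega t i) t.+2 - x omega t.+1.
Proof.
have supp i' : forall j, blk j != i' -> (x (upd omega t i') t.+2 - x omega t.+1) 0 j = 0.
  move=> j ji; have [+ _] := xstep (upd omega t i') t; rewrite ffunE eqxx => /(_ j ji).
  rewrite (@sboe_adapted _ omega t t.+1) //; first by rewrite !mxE => ->; rewrite subrr.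
  - exact: ltnW.
  - exact: agree_upd.
have -> : restr blk i (full_step omega t)
    = \sum_i' restr blk i (x (upd omega t i') t.+2 - x omega t.+1).
  apply: (big_morph (restr blk i)); first by move=> u v; rewrite restrD.
  by apply/rowP => j; rewrite !mxE; case: ifP.
rewrite (bigD1 i) //= restr_id; last exact: supp.
by rewrite big1 ?addr0 // => i' ii'; rewrite (restr_neq _ i') // 1?eq_sym //; exact: supp.
Qed.

Lemma sboe_step_full omega (t : 'I_k) :
  x omega t.+2 - x omega t.+1 = restr blk (omega t) (full_step omega t).
Proof. by rewrite restr_full_step upd_id. Qed.

Lemma sboe_feasible omega t : (t <= k.+1)%N -> prodX blk Xs (x omega t).
Proof.
have [e0 e1] := x01 omega.
elim/ltn_ind: t => -[_ _|[_ _|t IH tk]]; rewrite ?e0 ?e1 // => i.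
have tk' : (t < k)%N by [].
have [old [new _]] := xstep omega (Ordinal tk').
have [-> //|ni] := eqVneq i (omega (Ordinal tk')).
have -> : restr blk i (x omega t.+2) = restr blk i (x omega t.+1).
  apply/rowP => j; rewrite !mxE; case: eqP => // ji; apply: old.
  by rewrite ji.
by apply: IH => //; exact: ltnW.
Qed.

(** The proximal inequalities of the [b] alternative updates, one per block, add up to one for the
    full update, since both the feasible set and the inner product split over the blocks. *)
Lemma full_step_variational omega (t : 'I_k) z : prodX blk Xs z ->
  gam t.+1 * dotv (extrap omega t) (x omega t.+1 - z + full_step omega t)
  + dotv (full_step omega t) (x omega t.+1 - z + full_step omega t) <= 0.
Proof.
move=> Xz; set d := full_step omega t; set g := extrap omega t.
have tk := ltn_ord t.
have h i : dotv (restr blk i (gam t.+1 *: g + d))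
                (restr blk i (x omega t.+1 - z + d)) <= 0.
  have := xstep (upd omega t i) t; rewrite ffunE eqxx => st.
  have := sboe_step_variational _ _ _ _ _ _ _ _ _ _ _ _ _ (conv i) st (Xz i).
  have -> : x (upd omega t i) t.+2 = x omega t.+1 + restr blk i d.
    by rewrite restr_full_step addrC subrK.
  rewrite (@sboe_adapted _ omega t t.+1) ?(@sboe_adapted _ omega t t) //; try exact: ltnW;
    try exact: agree_upd.
  have rr : restr blk i (restr blk i d) = restr blk i d.
    by rewrite restr_id // => j ji; rewrite mxE (negbTE ji).
  rewrite -oppr_le0 -dotvNr opprB.
  have -> : restr blk i (x omega t.+1 + restr blk i d) = restr blk i (x omega t.+1 + d).
    by rewrite !restrD rr.
  by rewrite -!restrN -!restrD -restrZ -restrD [_ + d - _]addrC addKr addrAC.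
have : \sum_i dotv (restr blk i (gam t.+1 *: g + d))
                (restr blk i (x omega t.+1 - z + d)) <= 0 by apply: sumr_le0 => i _; exact: h.
by rewrite sum_dotv_restr dotvDl dotvZl.
Qed.

Lemma sum_step_noise_le0 (t : 'I_k) :
  \sum_omega step_noise b%:R (x omega t.+2 - x omega t.+1) (full_step omega t)
     (gam t.+1 *: extrap omega t + (x omega t.+1 - aux_seq omega t)) <= 0.
Proof.
have tk := ltn_ord t.
(* Draw [t] is averaged first: everything but the actual step is fixed by the earlier draws, so the
   inner sum is that of [sum_block_noise_le0]. *)
rewrite -(@pmulr_rle0 _ b%:R) ?ltr0n // -(sum_upd _ _ t).
apply: sumr_le0 => om _.
under eq_bigr => i _.
  have ag := agree_upd om t i t (leqnn t).
  rewrite (full_step_adapted _ _ _ tk ag) (aux_adapted _ _ _ (ltnW tk) ag) /extrap.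
  rewrite (sboe_adapted (ltnW tk) ag (leqnn _)) (sboe_adapted (ltnW tk) ag (leqnSn _)).
  rewrite -restr_full_step.
  over.
exact: sum_block_noise_le0.
Qed.

End Process.

(** * From the pathwise bound to the expected gap *)

(** Ensures that the [sup] of the final estimate is a true upper bound and not the default value of
    an unbounded set. *)
Lemma has_ubound_Vdist_affine (R : realType) (n : nat) (X : set 'rV[R]_n)
    (x1 f : 'rV[R]_n) (c a : R) : 0 <= c -> 0 <= a ->
  (exists M : R, forall x, X x -> enorm x <= M) ->
  has_ubound [set c * Vdist x1 y + a * dotv f (x1 - y) | y in X].
Proof.
move=> c0 a0 [M XM].
pose B := 2 * dotv x1 x1 + 2 * M ^+ 2.
exists (c * (2^-1 * B) + a * (2^-1 * (dotv f f + B))) => _ [y Xy <-].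
have yM : dotv y y <= M ^+ 2.
  have yM := XM _ Xy; have y0 : 0 <= enorm y by rewrite sqrtr_ge0.
  by rewrite -enorm_sqr ler_pXn2r ?nnegrE // (le_trans y0).
have pB : dotv (x1 - y) (x1 - y) <= B.
  by have := dotvv_ge0 (x1 + y); rewrite /B !dotvE (dotvC y x1); lra.
have fp : dotv f (x1 - y) <= 2^-1 * (dotv f f + dotv (x1 - y) (x1 - y)).
  move: (x1 - y) => p; have := dotvv_ge0 (f - p); rewrite !dotvE (dotvC p f); lra.
rewrite VdistE lerD ?ler_wpM2l //; lra.
Qed.

(** The weights sum to [Ssum], so the left side is an average over the iterates; monotonicity then
    replaces [F z] by [F] at each iterate. *)
Lemma xbar_gap_le (R : realType) (n b k : nat) (gam theta : nat -> R)
    (X : set 'rV[R]_n) (F : 'rV[R]_n -> 'rV[R]_n) (x : nat -> 'rV[R]_n) (z : 'rV[R]_n) :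
  0 < Ssum b k gam theta ->
  (forall t, (1 <= t <= k)%N -> 0 <= avg_weight b k gam theta t) ->
  (forall t, (1 <= t <= k)%N -> X (x t.+1)) -> X z ->
  (forall u v, X u -> X v -> 0 <= dotv (F u - F v) (u - v)) ->
  dotv (F z) (xbar b k gam theta x - z) <= (Ssum b k gam theta)^-1 *
   \sum_(1 <= t < k.+1) avg_weight b k gam theta t * dotv (F (x t.+1)) (x t.+1 - z).
Proof.
move=> S0 w0 Xx Xz mono.
have -> : dotv (F z) (xbar b k gam theta x - z) = (Ssum b k gam theta)^-1 *
   \sum_(1 <= t < k.+1) avg_weight b k gam theta t * dotv (F z) (x t.+1 - z).
  under [in RHS]eq_bigr do rewrite dotvDr dotvNr mulrDr mulrN.
  rewrite sumrB -mulr_suml -/(Ssum b k gam theta) mulrBr mulKf ?gt_eqF //.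
  rewrite dotvDr dotvNr dotvZr dotv_sumr.
  by under eq_bigr do rewrite dotvZr.
rewrite ler_wpM2l ?invr_ge0 ?(ltW S0) // big_nat_cond [leRHS]big_nat_cond.
apply: ler_sum => t; rewrite andbT ltnS => tk.
rewrite ler_wpM2l ?w0 //.
by have := mono _ _ (Xx _ tk) Xz; rewrite dotvDl dotvNl; lra.
Qed.

Lemma sboe_gap_bound (R : realType) (n b : nat) (blk : 'I_n -> 'I_b)
  (Xs : 'I_b -> set 'rV[R]_n) (F : 'rV[R]_n -> 'rV[R]_n) (L Lbar : R) (k : nat)
  (x1 : 'rV[R]_n) (gam lam theta : nat -> R)
  (x : {ffun 'I_k -> 'I_b} -> nat -> 'rV[R]_n) :
  (0 < b)%N -> (1 <= k)%N ->
  (forall i, convex_set_of (Xs i)) ->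
  (exists M : R, forall x, prodX blk Xs x -> enorm x <= M) ->
  (forall y z, prodX blk Xs y -> prodX blk Xs z ->
     enorm (F y - F z) <= L * enorm (y - z)) ->
  (forall i y z, prodX blk Xs y -> prodX blk Xs z ->
     enorm (restr blk i (F y) - restr blk i (F z)) <= Lbar * enorm (y - z)) ->
  (forall y z, prodX blk Xs y -> prodX blk Xs z ->
     0 <= dotv (F y - F z) (y - z)) ->
  prodX blk Xs x1 ->
  (forall t, 0 <= gam t) -> (forall t, 0 <= theta t) ->
  (forall t, (1 <= t <= k)%N ->
        [/\ theta t.+1 * gam t.+1 * lam t.+1 = theta t * gam t * b%:R,
            theta t.-1 * gam t.-1 * b%:R >= theta t * gam t * (b%:R - 1),
            theta t.-1 >= 16 * Lbar ^+ 2 * gam t ^+ 2 * lam t ^+ 2 * theta t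
          & theta t <= theta t.-1]) ->
  4 * L ^+ 2 * gam k ^+ 2 <= 1 ->
  0 < Ssum b k gam theta ->
  (forall omega, x omega 0%N = x1 /\ x omega 1%N = x1) ->
  (forall (omega : {ffun 'I_k -> 'I_b}) (t : 'I_k),
        sboe_step blk Xs F (gam t.+1) (lam t.+1) (omega t)
          (x omega t) (x omega t.+1) (x omega t.+2)) ->
  expect_unif (fun omega => gap (prodX blk Xs) F (xbar b k gam theta (x omega)))
     <= theta 1%N / Ssum b k gam theta *
        sup [set 5 * (b%:R + 1) * Vdist x1 y
                 + gam 1%N * (b%:R - 1) * dotv (F x1) (x1 - y) | y in prodX blk Xs].
Proof.
move=> b0 k1 conv bnd lip lipb mono Xx1 gam0 th0 par gamL S0 x01 xstep.
have par' t : (t < k)%N -> _ := fun tk => par t.+1 (tk : (1 <= t.+1 <= k)%N).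
have b1 : (1 : R) <= b%:R by rewrite ler1n.
have feas om t (tk : (t <= k.+1)%N) : prodX blk Xs (x om t).
  exact: (sboe_feasible _ _ _ _ _ _ _ Xx1 x01 xstep).
set B := sup _; set S := Ssum _ _ _ _.
pose N t om := step_noise b%:R (x om t.+2 - x om t.+1) (full_step x om t)
  (gam t.+1 *: (F (x om t.+1) + lam t.+1 *: (F (x om t.+1) - F (x om t)))
   + (x om t.+1 - aux_seq x1 x om t)).
pose Z om := \sum_(t < k) theta t.+1 * N t om.
have w0 t : (1 <= t <= k)%N -> 0 <= avg_weight b k gam theta t.
  move=> /andP[t1 tk]; rewrite /avg_weight; case: eqP => [_|/eqP tk'].
    by rewrite !mulr_ge0 ?ler0n.
  have {tk'} tk' : (t < k)%N by rewrite ltn_neqAle tk'.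
  (* The weight at [t] is controlled by the parameter condition at [t.+1]. *)
  by have [_ + _ _] := par' _ tk'; rewrite subr_ge0.
have gapZ om : gap (prodX blk Xs) F (xbar b k gam theta (x om))
    <= theta 1%N / S * B + S^-1 * Z om.
  have [e0 e1] := x01 om.
  apply: ge_sup.
    by exists (dotv (F x1) (xbar b k gam theta (x om) - x1)); exists x1.
  move=> _ [z Xz <-].
  apply: le_trans (xbar_gap_le _ _ _ _ _ _ _ _ _ _ S0 w0 _ Xz mono) _.
    by move=> t /andP[_ tk]; exact: feas.
  rewrite [theta _ / S]mulrC -mulrA -mulrDr ler_wpM2l ?invr_ge0 ?(ltW S0) //.
  have := path_bound _ _ b k gam lam theta L Lbar F (x om) (full_step x om)
    (aux_seq x1 x om) z b0 k1 th0 _ _ _ gamL.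
  rewrite e0 e1 => /(_ _ _ _ erefl) h.
  apply: le_trans (h _ _ _ _ _ _ _ _) _.
  - by move=> t /par'[].
  - by move=> t /par'[].
  - by move=> t /par'[].
  - by rewrite /aux_seq big_ord0 scaler0 subr0.
  - by move=> t; rewrite /aux_seq big_ord_recr /= scalerDr opprD addrA.
  - move=> t tk.
    exact: (full_step_variational _ _ _ _ _ _ _ conv x01 xstep om (Ordinal tk)).
  - move=> t tk; pose i := om (Ordinal tk).
    have st := sboe_step_full _ _ _ _ _ _ _ conv x01 xstep om (Ordinal tk).
    (* The step lives in the drawn block, so only that block of the difference of [F] matters, and
       [Lbar] bounds it. *)
    exists (restr blk i (F (x om t.+1) - F (x om t))).
      rewrite restrD restrN; apply: enorm_le_sqr; apply: lipb; apply: feas.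
        exact: ltnW.
      by rewrite ltnW // ltnW.
    by rewrite /= in st; rewrite st [RHS]dotvC dotv_restrl dotvC.
  - by apply: enorm_le_sqr; apply: lip; apply: feas.
  rewrite lerD2r ler_wpM2l //.
  apply: (@le_trans _ _ (5 * (b%:R + 1) * Vdist x1 z
                 + gam 1%N * (b%:R - 1) * dotv (F x1) (x1 - z))).
    (* This is 3b <= 5(b + 1). *)
    by rewrite lerD2r ler_wpM2r ?Vdist_ge0 //; lra.
  apply: ub_le_sup; last by exists z.
  by apply: has_ubound_Vdist_affine => //; rewrite mulr_ge0 ?subr_ge0 //; lra.
apply: le_trans (le_expect_unif _ _ gapZ) _.
(* It remains to see that [Z] has nonpositive mean, which holds for each [t] separately. *)
rewrite expect_unif_affine // gerDl pmulr_rle0 ?invr_gt0 //.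
rewrite /expect_unif -mulr_sumr mulr_ge0_le0 ?exprn_ge0 ?invr_ge0 ?ler0n //.
rewrite exchange_big /=; apply: sumr_le0 => t _.
rewrite -mulr_sumr mulr_ge0_le0 //.
exact: (sum_step_noise_le0 blk _ _ _ _ _ _ b0 conv x01 xstep).
Qed.

(** Summing the squares over the blocks gives the factor b, at most b^2. It supplies the Lipschitz
    constant [Lbar * b] for the particular step sizes. *)
Lemma enorm_le_blockwise (R : realType) (n b : nat) (blk : 'I_n -> 'I_b)
    (u v : 'rV[R]_n) (c : R) : (0 < b)%N -> 0 <= c ->
  (forall i, enorm (restr blk i u) <= c * enorm v) ->
  enorm u <= c * b%:R * enorm v.
Proof.
move=> b0 c0 h; have b1 : (1 : R) <= b%:R by rewrite ler1n.
rewrite -(@ler_pXn2r _ 2) ?nnegrE ?mulr_ge0 ?sqrtr_ge0 ?ler0n //.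
rewrite exprMn !enorm_sqr -(sum_dotv_restr blk u u).
apply: (@le_trans _ _ (\sum_(i < b) c ^+ 2 * dotv v v)).
  by apply: ler_sum => i _; exact: enorm_le_sqr.
rewrite sumr_const card_ord -[leLHS]mulr_natr.
have bb : (b%:R : R) <= b%:R ^+ 2 by nra.
have := ler_wpM2l (mulr_ge0 (sqr_ge0 c) (dotvv_ge0 v)) bb; lra.
Qed.

Theorem theorem4p2 (R : realType) (n b : nat) (blk : 'I_n -> 'I_b)
  (Xs : 'I_b -> set 'rV[R]_n) (F : 'rV[R]_n -> 'rV[R]_n) (L Lbar : R) (k : nat)
  (x1 : 'rV[R]_n) :
  (0 < b)%N -> (1 <= k)%N ->
  (forall i : 'I_b, exists j : 'I_n, blk j = i) ->
  (forall i, Xs i `<=` block_space blk i) ->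
  (forall i, Xs i !=set0) ->
  (forall i, closed (Xs i)) ->
  (forall i, convex_set_of (Xs i)) ->
  (exists M : R, forall x, prodX blk Xs x -> enorm x <= M) ->
  (forall y z, prodX blk Xs y -> prodX blk Xs z ->
     enorm (F y - F z) <= L * enorm (y - z)) ->
  (forall i y z, prodX blk Xs y -> prodX blk Xs z ->
     enorm (restr blk i (F y) - restr blk i (F z)) <= Lbar * enorm (y - z)) ->
  (forall y z, prodX blk Xs y -> prodX blk Xs z ->
     0 <= dotv (F y - F z) (y - z)) ->
  prodX blk Xs x1 ->
  (* general bound *)
  (forall (gam lam theta : nat -> R) (x : {ffun 'I_k -> 'I_b} -> nat -> 'rV[R]_n),
     (forall t, 0 <= gam t) -> (forall t, 0 <= lam t) -> (forall t, 0 <= theta t) ->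
     (forall t, (1 <= t <= k)%N ->
        [/\ theta t.+1 * gam t.+1 * lam t.+1 = theta t * gam t * b%:R,
            theta t.-1 * gam t.-1 * b%:R >= theta t * gam t * (b%:R - 1),
            theta t.-1 >= 16 * Lbar ^+ 2 * gam t ^+ 2 * lam t ^+ 2 * theta t
          & theta t <= theta t.-1]) ->
     4 * L ^+ 2 * gam k ^+ 2 <= 1 ->
     0 < Ssum b k gam theta ->
     (forall omega, x omega 0%N = x1 /\ x omega 1%N = x1) ->
     (forall (omega : {ffun 'I_k -> 'I_b}) (t : 'I_k),
        sboe_step blk Xs F (gam t.+1) (lam t.+1) (omega t)
          (x omega t) (x omega t.+1) (x omega t.+2)) ->
     expect_unif (fun omega => gap (prodX blk Xs) F (xbar b k gam theta (x omega)))
     <= theta 1%N / Ssum b k gam theta *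
        sup [set 5 * (b%:R + 1) * Vdist x1 y
                 + gam 1%N * (b%:R - 1) * dotv (F x1) (x1 - y) | y in prodX blk Xs])
  /\
  (* particular choice gam_t = 1/(4 Lbar b), lam_t = b, theta_t = 1 *)
  (forall (x : {ffun 'I_k -> 'I_b} -> nat -> 'rV[R]_n),
     0 < Lbar ->
     (forall omega, x omega 0%N = x1 /\ x omega 1%N = x1) ->
     (forall (omega : {ffun 'I_k -> 'I_b}) (t : 'I_k),
        sboe_step blk Xs F (4 * Lbar * b%:R)^-1 b%:R (omega t)
          (x omega t) (x omega t.+1) (x omega t.+2)) ->
     expect_unif (fun omega =>
        gap (prodX blk Xs) F
          (xbar b k (fun _ => (4 * Lbar * b%:R)^-1) (fun _ => 1) (x omega)))
     <= 4 * Lbar * b%:R / ((k - 1)%:R + b%:R) *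
        sup [set 5 * (b%:R + 1) * Vdist x1 y
                 + (b%:R - 1) / (4 * Lbar * b%:R) * dotv (F x1) (x1 - y)
             | y in prodX blk Xs]).
Proof.
move=> b0 k1 _ _ _ _ conv bnd lip lipb mono Xx1; split.
  move=> gam lam theta x gam0 lam0 th0 par gamL S0 x01 xstep.
  exact: (sboe_gap_bound _ _ _ _ _ _ L Lbar k x1 gam lam theta x).
move=> x Lb0 x01 xstep.
have b0' : (0 : R) < b%:R by rewrite ltr0n.
have Lbb : 0 < 4 * Lbar * b%:R by rewrite !mulr_gt0.
set gam := (4 * Lbar * b%:R)^-1.
have gam0 : 0 < gam by rewrite invr_gt0.
(* The regrouping with [c] constantly 1 gives [k] terms [gam] plus gam (b - 1). *)
have ES : Ssum b k (fun=> gam) (fun=> 1) = gam * ((k - 1)%:R + b%:R).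
  have := sum_avg_weight R b k (fun=> gam) (fun=> 1) (fun=> 1) k1.
  under eq_bigr do rewrite mulr1.
  rewrite -/(Ssum _ _ _ _) => ->.
  rewrite sumr_const card_ord -[X in X + _]mulr_natr natrB //; ring.
have S0 : 0 < Ssum b k (fun=> gam) (fun=> 1).
  by rewrite ES mulr_gt0 // ltr_wpDl ?ler0n.
have lip' y z : prodX blk Xs y -> prodX blk Xs z ->
    enorm (F y - F z) <= Lbar * b%:R * enorm (y - z).
  move=> Xy Xz; apply: (enorm_le_blockwise _ _ _ blk) => // [|i]; first exact: ltW.
  by rewrite restrD restrN; exact: lipb.
(* One identity serves two conditions: the one with factor 16 holds with equality, and the one with
   factor 4, for the constant [Lbar * b], reads 1/4 <= 1. *)
have gamL : 16 * (Lbar * b%:R) ^+ 2 * gam ^+ 2 = 1 by rewrite /gam; field; lra.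
have -> : (b%:R - 1) / (4 * Lbar * b%:R) = gam * (b%:R - 1) by rewrite mulrC.
have -> : 4 * Lbar * b%:R / ((k - 1)%:R + b%:R) = 1 / Ssum b k (fun=> gam) (fun=> 1).
  by rewrite ES div1r invfM invrK.
apply: (sboe_gap_bound _ _ _ _ _ _ (Lbar * b%:R) Lbar k x1 (fun=> gam) (fun=> b%:R)
  (fun=> 1) x) => //; first by move=> _; exact: ltW.
  by move=> t _; split; lra.
lra.
Qed.
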